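(* Let $M$ be a Gram matrix indexed by $\{0,1\}^n$, let $0\le\varepsilon\le1$, let $T=\mathrm{xpoly}_\varepsilon(M)$ and $\Pi_{\ge T}=\sum_{S:|S|\ge T}|\chi_S\rangle\langle\chi_S|$. Moreover, let $\delta>0$ be such that $\mathrm{tr}[\Pi_{\ge T}N]\ge\delta$ for every Gram matrix $N$ with $\mathcal F_H(N,M)\ge\sqrt{1-\varepsilon}$. Then, for every $c>1$, $$\mathrm{xpoly}_\varepsilon(M)-\frac{n-\log\delta}{\log c}\ \le\ \mathrm{MADV}^c_\varepsilon(M)\ \le\ \mathrm{xpoly}_\varepsilon(M)+\frac{n}{\log c}.$$ In particular, $$\lim_{c\to\infty}\mathrm{MADV}^c_\varepsilon(M)=\mathrm{xpoly}_\varepsilon(M).$$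
   Context: All matrices are complex matrices with rows and columns indexed by $\{0,1\}^n$; $\circ$ is the entrywise (Hadamard) product, $\mathbb I$ the identity, $\mathbb J$ the all-ones matrix, $A\succeq 0$ means Hermitian positive semidefinite, and $A\preceq B$ means $B-A\succeq0$. Logarithms are in base 2. A Gram matrix (always normalized) is a matrix $A\succeq 0$ with $A\circ\mathbb I=\mathbb I$ (all diagonal entries equal to 1). Fidelity: for density matrices $\rho,\sigma$ (positive semidefinite, trace 1), $\mathcal F(\rho,\sigma)=\mathrm{tr}\sqrt{\sqrt\rho\,\sigma\sqrt\rho}$. Hadamard product fidelity: for Gram matrices $A,B$, $\mathcal F_H(A,B)=\min_{u:\|u\|=1}\mathcal F(A\circ|u\rangle\langle u|,\,B\circ|u\rangle\langle u|)$, the minimum being over unit vectors $u\in\mathbb C^{\{0,1\}^n}$. Fourier basis: subsets $S\subseteq\{1,\dots,n\}$ are identified with their characteristic vectors in $\{0,1\}^n$, $|S|$ is the cardinality, and $|\chi_S\rangle=\frac1{\sqrt{2^n}}\sum_x(-1)^{S\cdot x}|x\rangle$. Extended polynomial bounds: for a Gram matrix $M$ and $0\le\varepsilon\le1$, $\mathrm{xpoly}_0(M)=\max_S\{|S|:\langle\chi_S|M|\chi_S\rangle\neq0\}$ and $\mathrm{xpoly}_\varepsilon(M)=\min_N\{\mathrm{xpoly}_0(N):\mathcal F_H(N,M)\ge\sqrt{1-\varepsilon},\ N\succeq0,\ N\circ\mathbb I=\mathbb I\}$. Multiplicative adversary bounds: for $i\in\{1,\dots,n\}$ let $D_i=\sum_{x,x'}(-1)^{x_i+x'_i}|x\rangle\langle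 x'|$. For $c>1$, $$\mathrm{MADV}^c_0(M)=\frac1{\log c}\max_{W\succeq0}\{\log\mathrm{tr}[WM]:\ \mathrm{tr}[W\mathbb J]=1,\ W\circ D_i\preceq cW\ \text{for all } i\},$$ $$\mathrm{MADV}^c_\varepsilon(M)=\min_N\{\mathrm{MADV}^c_0(N):\ \mathcal F_H(N,M)\ge\sqrt{1-\varepsilon},\ N\succeq0,\ N\circ\mathbb I=\mathbb I\}.$$ *)

(* Defs.v *)
From HB Require Import structures.
From mathcomp Require Import all_boot all_order all_algebra.
From mathcomp Require Import complex.
From mathcomp Require Import all_classical all_reals all_analysis.

Set Implicit Arguments.
Unset Strict Implicit.
Unset Printing Implicit Defensive.

Import Order.TTheory GRing.Theory Num.Theory.
Import numFieldNormedType.Exports.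

Local Open Scope classical_set_scope.
Local Open Scope ring_scope.
Local Open Scope complex_scope.
Local Open Scope sesquilinear_scope.

Definition bits (n : nat) : finType := {ffun 'I_n -> bool}.

(* Rows and columns are indexed by bit strings through [enum_val]: the index
   [a] stands for the bit string [enum_val a : bits n]. *)
Notation bdim n := #|{: bits n}|.

Section Matrices.
Context {R : realType}.
Local Notation C := R[i].

Definition hadamard (m : nat) (A B : 'M[C]_m) : 'M[C]_m :=
  map2_mx (fun a b => a * b) A B.

(* On [C] the order [0 <= z] means that z is real and nonnegative. *)
Definition psdmx (m : nat) (A : 'M[C]_m) : Prop :=
  A \is hermsymmx /\ forall u : 'cV[C]_m, 0 <= (u ^t* *m A *m u) 0 0.

Definition loewner_le (m : nat) (A B : 'M[C]_m) : Prop := psdmx (B - A).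

Definition gram (m : nat) (A : 'M[C]_m) : Prop :=
  psdmx A /\ hadamard A 1%:M = 1%:M.

(* Functional calculus: A = P^-1 *m diag_mx d *m P with P unitary whenever A is
   normal, so this is the positive semidefinite square root of a psd A. *)
Definition sqrtmx (m : nat) (A : 'M[C]_m) : 'M[C]_m :=
  invmx (spectralmx A) *m diag_mx (map_mx sqrtC (spectral_diag A))
    *m spectralmx A.

Definition fidelity (m : nat) (rho sigma : 'M[C]_m) : R :=
  complex.Re (\tr (sqrtmx (sqrtmx rho *m sigma *m sqrtmx rho))).

Definition unit_vector (m : nat) (u : 'cV[C]_m) : Prop :=
  (u ^t* *m u) 0 0 = 1.

Definition ketbra (m : nat) (u : 'cV[C]_m) : 'M[C]_m := u *m u ^t*.

(* A continuous function on the (compact) unit sphere: the minimum is attained,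
   and hence is the infimum. *)
Definition hadamard_fidelity (m : nat) (A B : 'M[C]_m) : R :=
  inf [set fidelity (hadamard A (ketbra u)) (hadamard B (ketbra u))
      | u in [set u : 'cV[C]_m | unit_vector u]].

(* The Gram matrices over which the epsilon-extended bounds are minimized. *)
Definition gram_near (m : nat) (eps : R) (M N : 'M[C]_m) : Prop :=
  gram N /\ Num.sqrt (1 - eps) <= hadamard_fidelity N M.

Definition chi (n : nat) (S : {set 'I_n}) : 'cV[C]_(bdim n) :=
  \col_a ((-1) ^+ #|[set i in S | (enum_val a : bits n) i]|
          / sqrtC (2 ^+ n)).

Definition xpoly0 (n : nat) (M : 'M[C]_(bdim n)) : nat :=
  (\max_(S : {set 'I_n} | (((chi S) ^t* *m M *m chi S) 0 0 != 0)%R) #|S|)%N.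

Definition nat_min (A : set nat) : nat := xget 0%N (A `&` lbound A).

Definition xpoly (n : nat) (eps : R) (M : 'M[C]_(bdim n)) : nat :=
  nat_min [set xpoly0 N | N in [set N | gram_near eps M N]].

Definition Pi_ge (n T : nat) : 'M[C]_(bdim n) :=
  \sum_(S : {set 'I_n} | (T <= #|S|)%N) ketbra (chi S).

Definition log2 (x : R) : R := ln x / ln 2.

Definition Dmx (n : nat) (i : 'I_n) : 'M[C]_(bdim n) :=
  \matrix_(a, b) (-1) ^+ ((enum_val a : bits n) i + (enum_val b : bits n) i).

Definition madv_witness (n : nat) (c : R) (W : 'M[C]_(bdim n)) : Prop :=
  [/\ psdmx W, \tr (W *m const_mx 1) = 1
    & forall i : 'I_n, loewner_le (hadamard W (Dmx i)) (c%:C *: W)].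

(* Since [ln 0 = 0] in the library, witnesses with tr[WM] = 0, whose objective
   value is log 0 = -oo, are excluded explicitly. The maximum is attained, and
   hence is the supremum. *)
Definition MADV0 (n : nat) (c : R) (M : 'M[C]_(bdim n)) : R :=
  (log2 c)^-1 *
  sup [set log2 (complex.Re (\tr (W *m M)))
      | W in [set W | madv_witness c W /\ 0 < complex.Re (\tr (W *m M))]].

(* Over the compact set of such N the minimum is attained and hence is the infimum. *)
Definition MADV (n : nat) (c eps : R) (M : 'M[C]_(bdim n)) : R :=
  inf [set MADV0 c N | N in [set N | gram_near eps M N]].

End Matrices.

Arguments Pi_ge R n T : clear implicits.

(* Main.v *)
Require Import Defs.
From HB Require Import structures.
From mathcomp Require Import all_boot all_order all_algebra.
From mathcomp Require Import complex.
From mathcomp Require Import all_classical all_reals all_analysis.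
From mathcomp Require Import ring lra.

Set Implicit Arguments.
Unset Strict Implicit.
Unset Printing Implicit Defensive.

(* Conjugating by the sign matrix of [i] permutes the Fourier basis,
   [chi S -> chi (S xor {i})].
   Upper bound: a witness [W] therefore satisfies
   [<chi_S|W|chi_S> <= c^|S| / 2^n], its value at [S = set0] being fixed by
   [tr(WJ) = 1].  A Gram matrix [N] of trace [2^n] has zero matrix elements
   outside the Fourier levels up to [xpoly0 N], so expanding [tr(WN)] in the
   Fourier basis and using Cauchy-Schwarz for [W] and [N] gives
   [|tr(WN)| <= 2^n * c^(xpoly0 N)].
   Lower bound: [W = 2^-n sum_S c^|S| |chi_S><chi_S|] is a witness with
   [tr(WN) >= 2^-n * c^T * tr(Pi_ge T N)].
   The infima are over a nonempty set because [M] is feasible: for positive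
   semidefinite [A], [sqrtmx (A^2) = A], so [F(A, A) = tr A]. *)

Import Order.TTheory GRing.Theory Num.Theory.
Import numFieldNormedType.Exports.

Local Open Scope classical_set_scope.
Local Open Scope ring_scope.

(** * Sesquilinear forms of positive semidefinite matrices *)

Section Forms.
Local Open Scope sesquilinear_scope.
Context {R : realType}.
Local Notation C := R[i].

Definition qform {m : nat} (A : 'M[C]_m) (u v : 'cV[C]_m) : C :=
  (u ^t* *m A *m v) 0 0.

Lemma adjmxE m k (A : 'M[C]_(m, k)) i j : A ^t* i j = (A j i)^*.
Proof. by rewrite !mxE. Qed.

Lemma ketbraE m (u : 'cV[C]_m) a b : ketbra u a b = u a 0 * (u b 0)^*.
Proof. by rewrite /ketbra mxE big_ord1 adjmxE. Qed.

Lemma qformE m (A : 'M[C]_m) u v :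
  qform A u v = \sum_a \sum_b (u a 0)^* * A a b * v b 0.
Proof.
rewrite /qform mxE exchange_big /=; apply: eq_bigr => b _.
by rewrite mxE mulr_suml; apply: eq_bigr => a _; rewrite !mxE.
Qed.

Lemma qformDr m (A : 'M[C]_m) u v w :
  qform A u (v + w) = qform A u v + qform A u w.
Proof. by rewrite /qform mulmxDr mxE. Qed.

Lemma qformZr m (A : 'M[C]_m) a u v : qform A u (a *: v) = a * qform A u v.
Proof. by rewrite /qform -scalemxAr mxE. Qed.

Lemma qformDl m (A : 'M[C]_m) u v w :
  qform A (v + w) u = qform A v u + qform A w u.
Proof. by rewrite /qform linearD map_mxD !mulmxDl mxE. Qed.

Lemma qformZl m (A : 'M[C]_m) a u v : qform A (a *: u) v = a^* * qform A u v.
Proof. by rewrite /qform linearZ map_mxZ -!scalemxAl mxE. Qed.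

Lemma qform_subm m (A B : 'M[C]_m) u v :
  qform (A - B) u v = qform A u v - qform B u v.
Proof. by rewrite /qform mulmxBr mulmxBl [LHS]mxE [X in _ + X]mxE. Qed.

Lemma qform_scalem m a (A : 'M[C]_m) u v :
  qform (a *: A) u v = a * qform A u v.
Proof. by rewrite /qform -scalemxAr -scalemxAl mxE. Qed.

Lemma hermsymmxE m (A : 'M[C]_m) : (A \is hermsymmx) = (A == A ^t*).
Proof. by rewrite is_hermitianmxE expr0 scale1r. Qed.

Lemma qform_conj m (A : 'M[C]_m) u v :
  A \is hermsymmx -> (qform A u v)^* = qform A v u.
Proof.
rewrite hermsymmxE => /eqP hA; rewrite !qformE rmorph_sum exchange_big /=.
apply: eq_bigr => a _; rewrite rmorph_sum; apply: eq_bigr => b _.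
have <- : (A b a)^* = A a b by rewrite [in RHS]hA !mxE.
by rewrite !rmorphM /= !conjCK; ring.
Qed.

Lemma qform_ge0 m (A : 'M[C]_m) u : psdmx A -> 0 <= qform A u u.
Proof. by move=> [_]; apply. Qed.


Lemma psdmx_CauchySchwarz m (A : 'M[C]_m) u v : psdmx A ->
  `|qform A u v| ^+ 2 <= qform A u u * qform A v v.
Proof.
move=> pA.
suff H u' v' : qform A u' u' != 0 ->
    `|qform A u' v'| ^+ 2 <= qform A u' u' * qform A v' v'.
  have [u0|/H//] := eqVneq (qform A u u) 0.
  have [v0|/(H _ u)] := eqVneq (qform A v v) 0; last first.
    by rewrite -(qform_conj v u pA.1) norm_conjC mulrC.
  (* Both diagonal values vanish here, so the form at this vector is [-2 |A(u,v)|^2]; its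
     nonnegativity forces [A(u,v) = 0]. *)
  have := qform_ge0 (- qform A u v *: u + v) pA.
  rewrite !(qformDl, qformDr, qformZl, qformZr) u0 v0 !mulr0 add0r addr0.
  rewrite -(qform_conj u v pA.1) normCK rmorphN /=.
  set z := qform A u v => h.
  have {}h : 0 <= - (2 * (z * z^*))
    by apply: le_trans h _; rewrite le_eqVlt; apply/orP; left; apply/eqP; ring.
  by move: h; rewrite oppr_ge0 pmulr_rle0// ltr0n.
move=> {u v} u0; set u := u'; set v := v'.
have up : 0 < qform A u u by rewrite lt_neqAle eq_sym u0 qform_ge0.
(* The form at this vector is [A(u,u) * (A(u,u) A(v,v) - |A(u,v)|^2)], and the positive factor
   cancels. *)
have := qform_ge0 (- qform A u v *: u + qform A u u *: v) pA.
rewrite !(qformDl, qformDr, qformZl, qformZr).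
rewrite -(qform_conj u v pA.1) normCK rmorphN /=.
have -> : (qform A u u)^* = qform A u u by rewrite qform_conj ?pA.1.
set z := qform A u v => h.
rewrite -subr_ge0 -(pmulr_rge0 _ up); apply: le_trans h _.
by rewrite le_eqVlt; apply/orP; left; apply/eqP; ring.
Qed.

Lemma psdmx_qform_eq0 m (A : 'M[C]_m) u v : psdmx A ->
  qform A u u = 0 -> qform A u v = 0.
Proof.
move=> pA u0; have := psdmx_CauchySchwarz u v pA; rewrite u0 mul0r => h.
by apply/eqP; rewrite -normr_eq0 -sqrf_eq0 eq_le h exprn_ge0.
Qed.

Lemma psdmx_qform_norm m (A : 'M[C]_m) u v b : psdmx A ->
  qform A u u <= b -> qform A v v <= b -> `|qform A u v| <= b.
Proof.
move=> pA ub vb; have b0 := le_trans (qform_ge0 u pA) ub.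
rewrite -(ler_pXn2r (ltn0Sn 1)) ?nnegrE//.
by rewrite (le_trans (psdmx_CauchySchwarz u v pA))// expr2 ler_pM ?qform_ge0.
Qed.

(** Cauchy-Schwarz followed by the inequality of arithmetic and geometric means. The arithmetic mean
    is additive, so double sums of such bounds reduce to traces. *)
Lemma psdmx_qform_norm_mean m (A : 'M[C]_m) u v : psdmx A ->
  `|qform A u v| <= (qform A u u + qform A v v) / 2.
Proof.
move=> pA; have u0 := qform_ge0 u pA; have v0 := qform_ge0 v pA.
have uv0 : 0 <= (qform A u u + qform A v v) / 2 by rewrite divr_ge0 ?addr_ge0.
rewrite -(ler_pXn2r (ltn0Sn 1)) ?nnegrE//.
apply: le_trans (psdmx_CauchySchwarz u v pA) _; rewrite -subr_ge0.
have -> : ((qform A u u + qform A v v) / 2) ^+ 2 - qform A u u * qform A v v =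
    ((qform A u u - qform A v v) / 2) ^+ 2 by field.
by rewrite real_exprn_even_ge0 // realM ?realB ?ger0_real ?invr_ge0.
Qed.

Lemma qform_ketbra m (w u v : 'cV[C]_m) :
  qform (ketbra w) u v = (u ^t* *m w) 0 0 * (w ^t* *m v) 0 0.
Proof. by rewrite /qform /ketbra mulmxA -mulmxA mxE big_ord1. Qed.

Lemma qform_mul_ketbra m (A B : 'M[C]_m) u v w :
  qform (A *m ketbra w *m B) u v = qform A u w * qform B w v.
Proof.
have E : u ^t* *m (A *m ketbra w *m B) *m v =
    (u ^t* *m A *m w) *m (w ^t* *m B *m v) by rewrite /ketbra !mulmxA.
by rewrite {1}/qform E mxE big_ord1.
Qed.

Lemma mxtrace_mul_ketbra m (A : 'M[C]_m) u :
  \tr (A *m ketbra u) = qform A u u.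
Proof.
by rewrite /ketbra /qform mulmxA mxtrace_mulC mulmxA /mxtrace big_ord1.
Qed.

Lemma ketbra_hermsymmx m (u : 'cV[C]_m) : ketbra u \is hermsymmx.
Proof.
rewrite hermsymmxE; apply/eqP/matrixP => i j.
by rewrite /ketbra !mxE rmorph_sum; apply: eq_bigr => k _;
  rewrite !mxE rmorphM /= conjCK mulrC.
Qed.

Lemma psdmx_ketbra m (u : 'cV[C]_m) : psdmx (ketbra u).
Proof.
split=> [|v]; first exact: ketbra_hermsymmx.
rewrite -[X in 0 <= X]/(qform _ v v) qform_ketbra.
have -> : (u ^t* *m v) 0 0 = ((v ^t* *m u) 0 0)^*.
  by rewrite !mxE rmorph_sum; apply: eq_bigr => k _;
  rewrite !mxE rmorphM /= conjCK mulrC.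
by rewrite -normCK exprn_ge0.
Qed.

Lemma psdmxD m (A B : 'M[C]_m) : psdmx A -> psdmx B -> psdmx (A + B).
Proof.
move=> [hA pA] [hB pB]; split=> [|u].
  by move: hA hB; rewrite !hermsymmxE linearD map_mxD => /eqP <- /eqP <-.
by rewrite mulmxDr mulmxDl mxE addr_ge0.
Qed.

Lemma psdmxZ m (a : C) (A : 'M[C]_m) : 0 <= a -> psdmx A -> psdmx (a *: A).
Proof.
move=> a0 [hA pA]; split=> [|u].
  move: hA; rewrite !hermsymmxE linearZ map_mxZ => /eqP <-.
  by rewrite /= (CrealP (ger0_real a0)).
by rewrite -scalemxAr -scalemxAl mxE mulr_ge0.
Qed.

Lemma psdmx0 m : psdmx (0 : 'M[C]_m).
Proof.
split=> [|u]; first by rewrite hermsymmxE linear0 map_mx0.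
by rewrite mulmx0 mul0mx mxE.
Qed.

Lemma psdmx_sum m (I : finType) (F : I -> 'M[C]_m) :
  (forall i, psdmx (F i)) -> psdmx (\sum_i F i).
Proof.
move=> h; apply: (big_ind (@psdmx R m)); first exact: psdmx0.
  by move=> A B; exact: psdmxD.
by move=> i _; exact: h.
Qed.


End Forms.

(** * The Fourier basis and the action of sign flips on it *)

Section Fourier.
Local Open Scope sesquilinear_scope.
Context {R : realType} {n : nat}.
Local Notation C := R[i].
Local Notation chi := (@chi R n).

Lemma sqrtC_exp2n_invM :
  (sqrtC (2 ^+ n : C))^-1 * (sqrtC (2 ^+ n))^-1 = (2 ^+ n)^-1.
Proof. by rewrite -invfM -expr2 sqrtCK. Qed.

Lemma chiE S a : chi S a 0 =
  (\prod_(i in S) (-1) ^+ ((enum_val a : bits n) i)) / sqrtC (2 ^+ n).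
Proof.
rewrite mxE; congr (_ / _).
rewrite (eq_bigr (fun i => if (enum_val a : bits n) i then -1 else 1)); last first.
  by move=> i _; case: (_ i).
rewrite -big_mkcondr prodr_const; congr (_ ^+ _); apply: eq_card => i.
by rewrite !inE.
Qed.

Lemma chi_conj S a : (chi S a 0)^* = chi S a 0.
Proof.
apply/CrealP; rewrite chiE rpred_div //; last first.
  by rewrite ger0_real // sqrtC_ge0 exprn_ge0.
by rewrite rpred_prod // => i _; rewrite rpredX // rpredN rpred1.
Qed.

(** The sum over [S] of products of signs factors as the product over [i] of [(-1)^(a_i + b_i) + 1],
    and a bit where [a] and [b] differ gives a zero factor. *)
Lemma sum_ketbra_chi : \sum_S ketbra (chi S) = 1%:M :> 'M[C]_(bdim n).
Proof.
apply/matrixP => a b; rewrite summxE [RHS]mxE.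
have E S : ketbra (chi S) a b = (\prod_i if i \in S
    then (-1) ^+ ((enum_val a : bits n) i + (enum_val b : bits n) i)
    else 1) / 2 ^+ n.
  rewrite ketbraE chi_conj !chiE.
  rewrite mulrACA sqrtC_exp2n_invM -big_split /= -big_mkcond /=; congr (_ * _).
  by apply: eq_bigr => i _; rewrite exprD.
under eq_bigr do rewrite E; rewrite -mulr_suml.
have <- := @bigA_distr C 0 1 *%R +%R _ (fun i => (-1) ^+ ((enum_val a : bits n) i
  + (enum_val b : bits n) i)) (fun=> 1).
have [->|ab] := eqVneq a b.
  rewrite (eq_bigr (fun=> 2)) => [|i _]; last by rewrite addnn -mul2n exprM sqrrN !expr1n.
  by rewrite prodr_const card_ord divff // expf_neq0 // pnatr_eq0.
have [i xi] : exists i, (enum_val a : bits n) i != (enum_val b : bits n) i.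
  apply/existsP; apply: contraNT ab; rewrite negb_exists => /forallP h.
  apply/eqP/enum_val_inj/ffunP => i.
  by apply/eqP; have := h i; rewrite negbK.
rewrite (bigD1 i) //=.
suff -> : (-1) ^+ ((enum_val a : bits n) i + (enum_val b : bits n) i) + 1 = 0 :> C.
  by rewrite !mul0r.
by move: xi; case: (_ i) (_ i) => -[] //= _; rewrite ?addn0 ?add0n expr1 addNr.
Qed.

Lemma chi_set0_dot S : ((chi finset.set0) ^t* *m chi S) 0 0 = (S == finset.set0)%:R.
Proof.
rewrite mxE.
have E a : (chi finset.set0)^t* 0 a * chi S a 0 =
    (\prod_i if i \in S then (-1) ^+ ((enum_val a : bits n) i) else 1) / 2 ^+ n.
  rewrite adjmxE chi_conj !chiE big_set0 mulrACA sqrtC_exp2n_invM mul1r.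
  by rewrite -big_mkcond.
under eq_bigr do rewrite E; rewrite -mulr_suml.
(* Summing over bit strings instead of matrix indices lets the coordinates vary independently, so
   the sum factors; each [i] in [S] contributes [1 - 1 = 0]. *)
rewrite -(reindex (enum_val : _ -> bits n) (op := +%R)
  (P := predT) (F := fun x : bits n =>
  (\prod_i if i \in S then (-1) ^+ (x i) else 1))) /=; last first.
  exact: onW_bij (enum_val_bij _).
have <- := @bigA_distr_bigA C 0 1 *%R +%R 'I_n bool (fun i b =>
  if i \in S then (-1) ^+ b else 1).
have [->|/set0Pn [i iS]] := eqVneq S finset.set0.
  rewrite (eq_bigr (fun=> 2)) => [|i _]; last by rewrite big_bool !inE.
  by rewrite prodr_const card_ord divff // expf_neq0 // pnatr_eq0.
by rewrite (bigD1 i) //= big_bool iS /= expr1 expr0 addNr !mul0r.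
Qed.

Lemma const_mx1_ketbra :
  const_mx 1 = 2 ^+ n *: ketbra (chi finset.set0) :> 'M[C]_(bdim n).
Proof.
apply/matrixP => a b; rewrite [LHS]mxE [RHS]mxE ketbraE chi_conj !chiE !big_set0.
by rewrite !mul1r sqrtC_exp2n_invM divff // expf_neq0 // pnatr_eq0.
Qed.

Lemma mxtrace_chi (A : 'M[C]_(bdim n)) : \tr A = \sum_S qform A (chi S) (chi S).
Proof.
rewrite -[A in LHS]mulmx1 -sum_ketbra_chi mulmx_sumr raddf_sum /=.
by apply: eq_bigr => S _; rewrite mxtrace_mul_ketbra.
Qed.

(** The resolution of the identity [sum_ketbra_chi] is inserted between [A] and [B]. *)
Lemma mxtrace_mul_chi (A B : 'M[C]_(bdim n)) : \tr (A *m B) =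
  \sum_S \sum_S' qform A (chi S) (chi S') * qform B (chi S') (chi S).
Proof.
rewrite mxtrace_chi; apply: eq_bigr => S _.
rewrite -[A in LHS]mulmx1 -sum_ketbra_chi mulmx_sumr mulmx_suml.
rewrite {1}/qform mulmx_sumr mulmx_suml summxE; apply: eq_bigr => S' _.
exact: qform_mul_ketbra.
Qed.

Definition phase_flip (i : 'I_n) (u : 'cV[C]_(bdim n)) : 'cV[C]_(bdim n) :=
  \col_a ((-1) ^+ (enum_val a : bits n) i * u a 0).

(** The entries of [Dmx i] factor into a row sign and a column sign, which are absorbed into the two
    vectors. *)
Lemma qform_Dmx (A : 'M[C]_(bdim n)) i u v :
  qform (hadamard A (Dmx i)) u v = qform A (phase_flip i u) (phase_flip i v).
Proof.
rewrite !qformE; apply: eq_bigr => a _; apply: eq_bigr => b _.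
have phase_flipE w j : phase_flip i w j 0 = (-1) ^+ (enum_val j : bits n) i * w j 0.
  by rewrite mxE.
rewrite !phase_flipE [hadamard _ _ _ _]mxE [Dmx _ _ _]mxE rmorphM /= rmorph_sign exprD.
by move: (u a 0)^* (A a b) (v b 0) ((-1) ^+ _) ((-1) ^+ _) => x y z s t; ring.
Qed.

Definition toggle (i : 'I_n) (S : {set 'I_n}) : {set 'I_n} :=
  if i \in S then (S :\ i)%SET else (i |: S)%SET.

Lemma toggleK i : involutive (toggle i).
Proof.
move=> S; rewrite /toggle; case: (boolP (i \in S)) => iS.
  by rewrite finset.setD11 finset.setD1K.
by rewrite finset.setU11 finset.setU1K.
Qed.

Lemma card_toggle_le i S : (#|toggle i S| <= #|S|.+1)%N.
Proof.
rewrite /toggle; case: ifP => iS; last by rewrite cardsU1 iS.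
by rewrite (cardsD1 i S) iS add1n !leqW.
Qed.

Lemma phase_flip_chi i S : phase_flip i (chi S) = chi (toggle i S).
Proof.
have H (S' : {set 'I_n}) : i \notin S' -> phase_flip i (chi S') = chi (i |: S')%SET.
  move=> iS; apply/colP => a; rewrite mxE !chiE mulrA; congr (_ / _).
  by rewrite big_setU1.
rewrite /toggle; case: ifPn => [iS|]; last exact: H.
(* With [i] in [S], [chi S] is itself a flip of [chi (S :\ i)], and the two flips cancel. *)
rewrite -{1}(finset.setD1K iS) -H ?finset.setD11 //.
by apply/colP => a; rewrite !mxE mulrA -signr_addb addbb mul1r.
Qed.

End Fourier.

(** * Upper bound on the trace of a witness against a Gram matrix *)

Section Bounds.
Local Open Scope sesquilinear_scope.
Local Open Scope complex_scope.
Context {R : realType} {n : nat}.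
Local Notation C := R[i].
Local Notation chi := (@chi R n).
Implicit Types (W N : 'M[C]_(bdim n)) (c : R) (S : {set 'I_n}).

Lemma gram_mxtrace m (N : 'M[C]_m) : gram N -> \tr N = m%:R.
Proof.
move=> [_ /matrixP hN]; rewrite /mxtrace (eq_bigr (fun=> 1)) => [|i _].
  by rewrite sumr_const card_ord.
by have := hN i i; rewrite !mxE eqxx mulr1.
Qed.

Lemma card_bits : #|{: bits n}| = (2 ^ n)%N.
Proof. by rewrite card_ffun card_bool card_ord. Qed.

Lemma card_set_ord : #|{: {set 'I_n}}| = (2 ^ n)%N.
Proof. by rewrite -cardsT -powersetT card_powerset cardsT card_ord. Qed.

(** Induction on [#|S|]: for [i] in [S], the constraint for [i] evaluated at [chi (S :\ i)] bounds
    the value at [chi S] by [c] times the value at [chi (S :\ i)]. *)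
Lemma madv_witness_diag c W S : 0 <= c -> madv_witness c W ->
  qform W (chi S) (chi S) <= c%:C ^+ #|S| / 2 ^+ n.
Proof.
move=> c0 [pW trW hD].
have W0 : qform W (chi finset.set0) (chi finset.set0) = (2 ^+ n)^-1.
  move: trW; rewrite const_mx1_ketbra -scalemxAr mxtraceZ mxtrace_mul_ketbra.
  by move=> h; apply: (mulfI (x := 2 ^+ n)); rewrite ?h ?divff // expf_neq0 // pnatr_eq0.
have [k Sk] : exists k, #|S| = k by exists #|S|.
elim: k S Sk => [S /eqP|k IH S Sk].
  by rewrite cards_eq0 => /eqP ->; rewrite W0 cards0 expr0 mul1r.
have [i iS] : exists i, i \in S by apply/set0Pn; rewrite -cards_eq0 Sk.
have Dk : #|(S :\ i)%SET| = k by move: Sk; rewrite (cardsD1 i) iS add1n => -[].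
have -> : chi S = phase_flip i (chi (S :\ i)%SET).
  by rewrite phase_flip_chi /toggle finset.setD11 finset.setD1K.
have := qform_ge0 (chi (S :\ i)%SET) (hD i).
rewrite qform_subm qform_scalem qform_Dmx subr_ge0 => h.
apply: le_trans h _.
by rewrite Sk exprS -mulrA ler_wpM2l ?ler0c // -Dk IH.
Qed.

Lemma qform_chi_eq0 N S : (xpoly0 N < #|S|)%N -> qform N (chi S) (chi S) = 0.
Proof.
move=> h; apply/eqP; apply: contraTT h => h; rewrite -leqNgt.
exact: (bigop.bigmax_sup S).
Qed.

Lemma witness_mxtrace_le c W N : 1 <= c -> madv_witness c W -> gram N ->
  `|\tr (W *m N)| <= 2 ^+ n * c%:C ^+ xpoly0 N.
Proof.
move=> c1 hW hN; have c0 : 0 <= c by apply: le_trans c1.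
have [pN _] := hN; have [pW _ _] := hW.
(* Since [1 <= c], [b] dominates the bound of [madv_witness_diag] at every level up to
   [xpoly0 N]. *)
set b : C := c%:C ^+ xpoly0 N / 2 ^+ n.
have b0 : 0 <= b by rewrite divr_ge0 ?exprn_ge0 ?ler0c.
(* If [S] or [S'] lies above level [xpoly0 N], a zero diagonal value kills the element of [N].
   Otherwise [b] bounds the element of [W], and the mean of two diagonal values bounds that of
   [N]. *)
have hS S S' : `|qform W (chi S) (chi S') * qform N (chi S') (chi S)| <=
    b * ((qform N (chi S') (chi S') + qform N (chi S) (chi S)) / 2).
  have [|hS'] := ltnP (xpoly0 N) #|S'|.
    move=> /qform_chi_eq0 /(psdmx_qform_eq0 (chi S) pN) ->.
    by rewrite mulr0 normr0 mulr_ge0 // divr_ge0 ?addr_ge0 ?qform_ge0.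
  have [|hS] := ltnP (xpoly0 N) #|S|.
    move=> /qform_chi_eq0 /(psdmx_qform_eq0 (chi S') pN) N0.
    rewrite -(qform_conj _ _ pN.1) N0 conjC0 mulr0 normr0 mulr_ge0 //.
    by rewrite divr_ge0 ?addr_ge0 ?qform_ge0.
  rewrite normrM ler_pM ?psdmx_qform_norm_mean //.
  apply: psdmx_qform_norm => //; apply: le_trans (madv_witness_diag _ c0 hW) _;
    by rewrite ler_wpM2r ?invr_ge0 ?exprn_ge0 // -!rmorphXn lecR /= ler_weXn2l.
rewrite mxtrace_mul_chi; apply: le_trans (ler_norm_sum _ _ _) _.
apply: le_trans (_ : \sum_S \sum_S'
  b * ((qform N (chi S') (chi S') + qform N (chi S) (chi S)) / 2) <= _).
  apply: ler_sum => S _; apply: le_trans (ler_norm_sum _ _ _) _.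
  by apply: ler_sum => S' _.
(* Over all pairs [S], [S'], either diagonal value sums to [2^n * 2^n], so the total is
   [b * 4^n = 2^n * c^(xpoly0 N)]. *)
have DE : \sum_S' qform N (chi S') (chi S') = 2 ^+ n.
  by rewrite -mxtrace_chi gram_mxtrace // card_bits natrX.
under eq_bigr do rewrite -mulr_sumr -mulr_suml big_split /= DE
  sumr_const card_set_ord -[_ *+ (2 ^ n)%N]mulr_natl natrX.
rewrite -mulr_sumr -mulr_suml big_split /= -mulr_sumr DE.
rewrite sumr_const card_set_ord -[_ *+ (2 ^ n)%N]mulr_natl natrX /b.
rewrite le_eqVlt; apply/orP; left; apply/eqP.
have : 2 ^+ n != 0 :> C by rewrite expf_neq0 // pnatr_eq0.
by move: (2 ^+ n) (_ ^+ xpoly0 N) => x y x0; field.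
Qed.

End Bounds.

(** * The explicit witness and two-sided bounds on [MADV0] *)

Section Witness.
Local Open Scope sesquilinear_scope.
Local Open Scope complex_scope.
Context {R : realType} {n : nat}.
Local Notation C := R[i].
Local Notation chi := (@chi R n).
Implicit Types (N : 'M[C]_(bdim n)) (c delta : R) (S : {set 'I_n}).

Lemma Re_le (x y : C) : x <= y -> complex.Re x <= complex.Re y.
Proof. by rewrite lecE => /andP[]. Qed.

Lemma Re_realM (a : R) (x : C) : complex.Re (a%:C * x) = a * complex.Re x.
Proof. by case: x => x y /=; rewrite mul0r subr0. Qed.

Lemma Re_sum (I : finType) (P : pred I) (F : I -> C) :
  complex.Re (\sum_(i | P i) F i) = \sum_(i | P i) complex.Re (F i).
Proof. by elim/big_rec2: _ => // i x y _ <-; case: (F i) y => ? ? []. Qed.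

(** Diagonal in the Fourier basis, with the largest diagonal values that [madv_witness_diag]
    permits. *)
Definition weight_witness c : 'M[C]_(bdim n) :=
  \sum_(S : {set 'I_n}) (c ^+ #|S| / 2 ^+ n)%:C *: ketbra (chi S).

Lemma hadamard_ketbra_chi S i :
  hadamard (ketbra (chi S)) (Dmx i) = ketbra (chi (toggle i S)).
Proof.
apply/matrixP => a b; rewrite -phase_flip_chi [LHS]mxE !ketbraE [Dmx _ _ _]mxE exprD.
rewrite [phase_flip i _ a _]mxE [phase_flip i _ b _]mxE rmorphM /= rmorph_sign.
by rewrite mulrC mulrACA.
Qed.

Lemma madv_weight_witness c : 1 <= c -> madv_witness c (weight_witness c).
Proof.
move=> c1; have c0 : 0 <= c by apply: le_trans c1.
have w0 k : 0 <= c ^+ k / 2 ^+ n by rewrite divr_ge0 ?exprn_ge0.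
split.
- apply: psdmx_sum => S; apply: psdmxZ; last exact: psdmx_ketbra.
  by rewrite ler0c.
- rewrite const_mx1_ketbra -scalemxAr mxtraceZ mulmx_suml raddf_sum /=.
  (* The all-ones matrix is a multiple of the projector on [chi set0], so only the empty set
     contributes. *)
  rewrite (bigD1 finset.set0) //= big1 => [|S S0].
    rewrite addr0 -scalemxAl mxtraceZ mxtrace_mul_ketbra qform_ketbra.
    rewrite !chi_set0_dot eqxx !mulr1 finset.cards0 expr0 mul1r fmorphV rmorphXn /=.
    by rewrite rmorph_nat divff // expf_neq0 // pnatr_eq0.
  rewrite -scalemxAl mxtraceZ mxtrace_mul_ketbra qform_ketbra.
  by rewrite !chi_set0_dot (negPf S0) mul0r mulr0.
- move=> i.
  (* Reindexing by [toggle i] makes both sides of the constraint diagonal in the Fourier basis. It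
     then reads [c^#|toggle i S| <= c^(#|S|+1)], true because toggling adds at most one element. *)
  have -> : hadamard (weight_witness c) (Dmx i) =
      \sum_(S : {set 'I_n}) (c ^+ #|toggle i S| / 2 ^+ n)%:C *: ketbra (chi S).
    rewrite (reindex_inj (inv_inj (toggleK i))) /=.
    apply/matrixP => a b; rewrite [LHS]mxE /weight_witness !summxE mulr_suml.
    apply: eq_bigr => S _; rewrite toggleK -hadamard_ketbra_chi.
    by rewrite [in LHS]mxE [RHS]mxE [in RHS]mxE mulrA.
  rewrite /loewner_le scaler_sumr -sumrB; apply: psdmx_sum => S.
  rewrite scalerA -scalerBl; apply: psdmxZ; last exact: psdmx_ketbra.
  rewrite -rmorphM -rmorphB /= ler0c mulrA -exprS -mulrBl.
  by rewrite divr_ge0 ?exprn_ge0 // subr_ge0 ler_weXn2l // card_toggle_le.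
Qed.

Lemma mxtrace_Pi_ge N T :
  \tr (Pi_ge R n T *m N) = \sum_(S : {set 'I_n} | (T <= #|S|)%N) qform N (chi S) (chi S).
Proof.
rewrite mxtrace_mulC /Pi_ge mulmx_sumr raddf_sum /=.
by apply: eq_bigr => S _; rewrite mxtrace_mul_ketbra.
Qed.

(** Terms with [T <= #|S|] carry weight at least [c^T / 2^n]; the remaining terms are nonnegative
    and are dropped. *)
Lemma mxtrace_weight_witness N c T : 1 <= c -> psdmx N ->
  c ^+ T / 2 ^+ n * complex.Re (\tr (Pi_ge R n T *m N)) <=
  complex.Re (\tr (weight_witness c *m N)).
Proof.
move=> c1 pN; have c0 : 0 <= c by apply: le_trans c1.
have q0 S : 0 <= complex.Re (qform N (chi S) (chi S)).
  exact: Re_le (qform_ge0 (chi S) pN).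
have -> : \tr (weight_witness c *m N) = \sum_(S : {set 'I_n})
    (c ^+ #|S| / 2 ^+ n)%:C * qform N (chi S) (chi S).
  rewrite mxtrace_mulC /weight_witness mulmx_sumr raddf_sum.
  by apply: eq_bigr => S _; rewrite -scalemxAr /= mxtraceZ mxtrace_mul_ketbra.
rewrite mxtrace_Pi_ge !Re_sum mulr_sumr [leLHS]big_mkcond; apply: ler_sum => S _ /=.
rewrite Re_realM.
case: ifPn => TS; last by rewrite mulr_ge0 // divr_ge0 ?exprn_ge0.
by rewrite !ler_wpM2r ?invr_ge0 ?exprn_ge0 // ler_weXn2l.
Qed.

Lemma log2_gt0 c : 1 < c -> 0 < log2 c.
Proof. by move=> c1; rewrite divr_gt0 ?ln_gt0 // ltr1n. Qed.

Lemma le_log2 (x y : R) : 0 < x -> x <= y -> log2 x <= log2 y.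
Proof.
move=> x0 xy; have y0 := lt_le_trans x0 xy.
by rewrite ler_wpM2r ?ler_ln // invr_ge0 ltW // ln_gt0 // ltr1n.
Qed.

Lemma log2M (x y : R) : 0 < x -> 0 < y -> log2 (x * y) = log2 x + log2 y.
Proof. by move=> x0 y0; rewrite /log2 lnM // mulrDl. Qed.

Lemma log2X (x : R) k : 0 < x -> log2 (x ^+ k) = k%:R * log2 x.
Proof. by move=> x0; rewrite /log2 lnXn // mulr_natl mulrnAl. Qed.

Lemma log2_2 : log2 2 = 1 :> R.
Proof. by rewrite /log2 divff // gt_eqF // ln_gt0 // ltr1n. Qed.

(** Serves both directions: it bounds [MADV0] from above, and it supplies the boundedness that lets
    a single witness bound the supremum from below. *)
Lemma log2_witness_le c N : 1 < c -> gram N ->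
  ubound [set log2 (complex.Re (\tr (W *m N)))
    | W in [set W | madv_witness c W /\ 0 < complex.Re (\tr (W *m N))]]
    (n%:R + (xpoly0 N)%:R * log2 c).
Proof.
move=> c1 hN _ [W [hW tr0] <-].
have c0 : 0 < c by apply: lt_trans c1.
have -> : n%:R + (xpoly0 N)%:R * log2 c = log2 (2 ^+ n * c ^+ xpoly0 N).
  by rewrite log2M ?exprn_gt0 // !log2X // log2_2 mulr1.
apply: le_log2 => //; have := witness_mxtrace_le (ltW c1) hW hN.
set z := \tr _ => h; have {}h := le_trans (normc_ge_Re z) h.
apply: le_trans (ler_norm _) _; rewrite -lecR.
by apply: le_trans h _; rewrite rmorphM !rmorphXn /= rmorph_nat.
Qed.

Lemma MADV0_le c N : 1 < c -> gram N ->
  MADV0 c N <= (xpoly0 N)%:R + n%:R / log2 c.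
Proof.
move=> c1 hN; have l0 := log2_gt0 c1.
have u0 : 0 <= (xpoly0 N)%:R + n%:R / log2 c :> R.
  by rewrite addr_ge0 // divr_ge0 // ltW.
rewrite /MADV0; set A := [set _ | _ in _].
(* An empty set has [sup] equal to 0, which the nonnegative bound [u0] dominates. *)
have [->|/set0P A0] := eqVneq A set0; first by rewrite sup0 mulr0.
rewrite mulrC ler_pdivrMr // mulrDl divfK ?gt_eqF // addrC.
exact: (ge_sup A0 (log2_witness_le c1 hN)).
Qed.

Lemma MADV0_ge c N T delta : 1 < c -> gram N -> 0 < delta ->
  delta <= complex.Re (\tr (Pi_ge R n T *m N)) ->
  T%:R - (n%:R - log2 delta) / log2 c <= MADV0 c N.
Proof.
move=> c1 hN d0 hd; have l0 := log2_gt0 c1.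
have c0 : 0 < c by apply: lt_trans c1.
have w0 : 0 < c ^+ T / 2 ^+ n by rewrite divr_gt0 ?exprn_gt0.
have hW := mxtrace_weight_witness T (ltW c1) hN.1.
have {}hW : c ^+ T / 2 ^+ n * delta <= complex.Re (\tr (weight_witness c *m N)).
  by apply: le_trans hW; rewrite ler_wpM2l // ltW.
have p0 : 0 < c ^+ T / 2 ^+ n * delta by rewrite mulr_gt0.
rewrite /MADV0 [leRHS]mulrC ler_pdivlMr // mulrBl divfK ?gt_eqF //.
apply: le_trans (ub_le_sup (ex_intro _ _ (log2_witness_le c1 hN)) _); last first.
  (* The hypothesis [0 < delta] makes the trace positive, as membership in the set of objective
     values demands. *)
  exists (weight_witness c); last by reflexivity.
  by split; [exact/madv_weight_witness/ltW | exact: lt_le_trans hW].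
apply: le_trans (le_log2 p0 hW).
rewrite !log2M ?invr_gt0 ?exprn_gt0 // log2X //.
have -> : log2 (2 ^+ n)^-1 = - n%:R :> R.
  by rewrite /log2 lnV ?posrE ?exprn_gt0 // mulNr -/(log2 _) log2X // log2_2 mulr1.
lra.
Qed.

End Witness.

(** * Independence of the square root from the chosen diagonalization *)

Section DiagonalSquareRoots.
Context {C : numClosedFieldType}.

Lemma diag_conj_sqr m (P : 'M[C]_m) (d : 'rV[C]_m) : P \in unitmx ->
  (invmx P *m diag_mx (map_mx sqrtC d) *m P) *m
  (invmx P *m diag_mx (map_mx sqrtC d) *m P) = invmx P *m diag_mx d *m P.
Proof.
move=> uP; rewrite -!mulmxA mulKVmx // [diag_mx _ *m (diag_mx _ *m _)]mulmxA.
rewrite mulmx_diag; congr (_ *m (diag_mx _ *m _)).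
by apply/rowP => i; rewrite !mxE -expr2 sqrtCK.
Qed.

Lemma sqrt_diag_mx_intertwine m (d e : 'rV[C]_m) (U : 'M[C]_m) :
  (forall i, 0 <= d 0 i) ->
  diag_mx e *m U = U *m (diag_mx d *m diag_mx d) ->
  diag_mx (map_mx sqrtC e) *m U = U *m diag_mx d.
Proof.
move=> d0 EU; apply/matrixP => i j; move/matrixP/(_ i j): EU.
rewrite mulmx_diag !mul_diag_mx !mul_mx_diag !mxE.
(* Entrywise the hypothesis is [e_i U_ij = U_ij d_j^2]. Where [U_ij] is nonzero, [e_i = d_j^2],
   whose [sqrtC] is [d_j] because [d_j] is nonnegative. *)
have [->|U0] := eqVneq (U i j) 0; first by rewrite !mulr0 !mul0r.
rewrite mulrC => /(mulfI U0) ->.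
by rewrite -expr2 sqrCK // mulrC.
Qed.

(* [U = Q P^-1] satisfies [e U = U d^2], so that [U i j] vanishes unless
   [e i = d j ^ 2], whence also [sqrt e U = U d]. *)
Lemma sqrt_diag_conj m (A P Q : 'M[C]_m) (d e : 'rV[C]_m) :
  P \in unitmx -> Q \in unitmx -> (forall i, 0 <= d 0 i) ->
  A = invmx P *m diag_mx d *m P -> A *m A = invmx Q *m diag_mx e *m Q ->
  invmx Q *m diag_mx (map_mx sqrtC e) *m Q = A.
Proof.
move=> uP uQ d0 hA hAA.
have PA : P *m A = diag_mx d *m P by rewrite hA -mulmxA mulKVmx.
have QAA : Q *m (A *m A) = diag_mx e *m Q by rewrite hAA -mulmxA mulKVmx.
have AP : A *m invmx P = invmx P *m diag_mx d by rewrite hA mulmxK.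
have sU : diag_mx (map_mx sqrtC e) *m (Q *m invmx P) = Q *m invmx P *m diag_mx d.
  apply: sqrt_diag_mx_intertwine => //.
  by rewrite mulmxA -QAA -!mulmxA AP [A *m (invmx P *m _)]mulmxA AP !mulmxA.
have sQ : diag_mx (map_mx sqrtC e) *m Q = Q *m A.
  by rewrite -[Q in LHS](mulmxKV uP) mulmxA sU hA !mulmxA.
by rewrite -mulmxA sQ mulKmx.
Qed.

End DiagonalSquareRoots.

(** * Fidelity of a matrix with itself, and feasibility of [M] *)

Section Fidelity.
Local Open Scope sesquilinear_scope.
Context {R : realType}.
Local Notation C := R[i].

Lemma psdmx_normal m (A : 'M[C]_m) : psdmx A -> A \is normalmx.
Proof. by move=> [hA _]; apply: hermitian_normalmx. Qed.

Lemma spectral_diag_ge0 m (A : 'M[C]_m) i : psdmx A -> 0 <= spectral_diag A 0 i.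
Proof.
move=> pA; have /orthomx_spectralP := psdmx_normal pA.
set P := spectralmx A; set D := diag_mx _ => hA.
have uP : P \in unitmx by exact: spectral_unit.
have PV : invmx P = P ^t* by apply: invmx_unitary; exact: spectral_unitarymx.
(* Column [i] of the adjoint of the unitary [P] is an eigenvector, at which the form equals the
   [i]-th eigenvalue. *)
have : 0 <= qform A (col i (P ^t*)) (col i (P ^t*)) by exact: qform_ge0.
have -> : qform A (col i (P ^t*)) (col i (P ^t*)) = (P *m A *m invmx P) i i.
  have ut : (col i (P ^t*)) ^t* = row i P.
    by apply/matrixP => a b; rewrite !mxE conjCK.
  rewrite /qform ut PV -row_mul mxE [RHS]mxE.
  by apply: eq_bigr => k _; rewrite [row _ _ _ _]mxE [col _ _ _ _]mxE.
rewrite {1}hA !mulmxA mulmxV // mul1mx -mulmxA mulmxV // mulmx1.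
by rewrite mxE eqxx mulr1n.
Qed.

Lemma sqrtmx_sqr_psd m (A : 'M[C]_m) : psdmx A ->
  sqrtmx A *m sqrtmx A = A.
Proof.
move=> pA; have /orthomx_spectralP hA := psdmx_normal pA.
rewrite [RHS]hA; exact/diag_conj_sqr/spectral_unit.
Qed.

(** The chosen eigenbases of [A] and [A *m A] may differ, for instance in degenerate eigenspaces;
    [sqrt_diag_conj] compares them. *)
Lemma sqrtmx_mulmx m (A : 'M[C]_m) : psdmx A -> sqrtmx (A *m A) = A.
Proof.
move=> pA; have /orthomx_spectralP hA := psdmx_normal pA.
have /orthomx_spectralP hAA : A *m A \is normalmx.
  apply/hermitian_normalmx; move: pA.1; rewrite !hermsymmxE => /eqP hA'.
  by rewrite trmx_mul map_mxM -hA'.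
apply: (sqrt_diag_conj (spectral_unit A) (spectral_unit _) _ hA hAA) => i.
exact: spectral_diag_ge0.
Qed.

(** The Hadamard product with [ketbra u] is [diag(u) A diag(u)^*], so its form at [v] is that of [A]
    at the entrywise product of the conjugate of [u] with [v]. *)
Lemma psdmx_hadamard_ketbra m (A : 'M[C]_m) u :
  psdmx A -> psdmx (hadamard A (ketbra u)).
Proof.
move=> pA; split=> [|v].
  move: pA.1 (ketbra_hermsymmx u); rewrite !hermsymmxE.
  move=> /eqP/matrixP hA /eqP/matrixP hu; apply/eqP/matrixP => i j.
  rewrite adjmxE ![hadamard _ _ _ _]mxE rmorphM /=.
  by rewrite -!adjmxE -hA -hu.
rewrite -[X in 0 <= X]/(qform _ v v).
suff -> : qform (hadamard A (ketbra u)) v v =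
    qform A (\col_i ((u i 0)^* * v i 0)) (\col_i ((u i 0)^* * v i 0)).
  exact: qform_ge0.
rewrite !qformE; apply: eq_bigr => a _; apply: eq_bigr => b _.
have colE' i : (\col_i ((u i 0)^* * v i 0)) i 0 = (u i 0)^* * v i 0 by rewrite mxE.
rewrite !colE' [hadamard _ _ _ _]mxE ketbraE rmorphM /= conjCK.
move: (u a 0) (u b 0)^* (v a 0)^* (v b 0) (A a b) => x y z s t; ring.
Qed.

Lemma fidelity_refl m (A : 'M[C]_m) : psdmx A -> fidelity A A = complex.Re (\tr A).
Proof.
move=> pA; rewrite /fidelity.
suff -> : sqrtmx A *m A *m sqrtmx A = A *m A by rewrite sqrtmx_mulmx.
have AS := sqrtmx_sqr_psd pA; move: (sqrtmx A) AS => S <-.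
by rewrite !mulmxA.
Qed.

Lemma gram_near_refl n (eps : R) (M : 'M[C]_(bdim n)) :
  gram M -> 0 <= eps -> gram_near eps M M.
Proof.
move=> hM eps0; split=> //.
have uchi : unit_vector (@chi R n finset.set0).
  by rewrite /unit_vector (@chi_set0_dot R n) eqxx.
(* A lower bound passes to [inf] only for a nonempty set, hence the explicit unit vector. *)
apply: lb_le_inf; first by eexists; exists (chi finset.set0); first exact: uchi.
move=> _ [u hu <-].
rewrite fidelity_refl; last by apply: psdmx_hadamard_ketbra; exact: hM.1.
(* The unit diagonal of [M] reduces the trace to the squared norm of [u]. *)
have -> : \tr (hadamard M (ketbra u)) = 1.
  rewrite -[RHS]hu mxE; apply: eq_bigr => i _.
  have := congr1 (fun A : 'M[C]_(bdim n) => A i i) hM.2.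
  rewrite mxE [1%:M i i]mxE eqxx mulr1 => Mii.
  by rewrite mxE Mii mul1r ketbraE adjmxE mulrC.
by rewrite -[leRHS]sqrtr1 ler_wsqrtr // gerBl.
Qed.

End Fidelity.

(** * Attained minima of sets of naturals, and limits in [c] *)

Section Limit.
Context {R : realType}.

Lemma nat_min_mem (A : set nat) : A !=set0 -> A (nat_min A).
Proof.
move=> [a Aa]; have exA : exists k, `[< A k >] by exists a; apply/asboolP.
case: (ex_minnP exA) => k /asboolP Ak kmin.
suff : (exists x, (A `&` lbound A) x) by move=> /(xgetPex 0%N)[].
by exists k; split=> // x Ax; apply: kmin; apply/asboolP.
Qed.

Lemma cvg_log2_pinfty : (log2 c : R) @[c --> +oo] --> +oo.
Proof.
apply/cvgryPge => A; near=> c.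
have c0 : 0 < c by near: c; exact: nbhs_pinfty_gt.
(* The condition becomes [exp(A * ln 2) <= c], which holds eventually. *)
rewrite ler_pdivlMr ?ln_gt0 ?ltr1n // -ler_expR lnK ?posrE //.
Unshelve. all: by end_near. Qed.

Lemma cvg_div_log2 (k : R) : k / log2 c @[c --> +oo] --> (0 : R).
Proof.
have V0 : ((log2 c)^-1 : R) @[c --> +oo] --> (0 : R).
  apply/gtr0_cvgV0; last exact: cvg_log2_pinfty.
  by near=> c; apply: log2_gt0; near: c; exact: nbhs_pinfty_gt.
by rewrite -[X in _ --> X](mulr0 k); exact: cvgM (cvg_cst _) V0.
Unshelve. all: by end_near. Qed.

End Limit.

(** * The bounds on [MADV] and its limit *)

Local Open Scope complex_scope.

Theorem theorem14 (R : realType) (n : nat) (M : 'M[R[i]]_(bdim n))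
  (eps delta : R) (hM : gram M) (heps0 : 0 <= eps) (heps1 : eps <= 1)
  (hdelta0 : 0 < delta)
  (hdelta : forall N : 'M[R[i]]_(bdim n), gram_near eps M N ->
     delta <= complex.Re (\tr (Pi_ge R n (xpoly eps M) *m N))) :
  (forall c : R, 1 < c ->
     (xpoly eps M)%:R - (n%:R - log2 delta) / log2 c <= MADV c eps M
     /\ MADV c eps M <= (xpoly eps M)%:R + n%:R / log2 c)
  /\ MADV c eps M @[c --> +oo] --> ((xpoly eps M)%:R : R).
Proof.
have nearM := gram_near_refl hM heps0.
(* A minimizer for [xpoly]; evaluating [MADV0] at this [N] yields the upper bound. *)
have [N nearN xN] : exists2 N, gram_near eps M N & xpoly0 N = xpoly eps M.
  have [|N nearN xN] :=
      @nat_min_mem [set xpoly0 N | N in [set N | gram_near eps M N]].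
    by exists (xpoly0 M), M.
  by exists N.
have bounds c : 1 < c ->
    (xpoly eps M)%:R - (n%:R - log2 delta) / log2 c <= MADV c eps M
    /\ MADV c eps M <= (xpoly eps M)%:R + n%:R / log2 c.
  move=> c1.
  (* The level [xpoly eps M] and [delta] are the same for all feasible [N'], so the bound is
     uniform. It also shows that the infimum is over a set bounded below. *)
  have lb : lbound [set MADV0 c N' | N' in [set N' | gram_near eps M N']]
      ((xpoly eps M)%:R - (n%:R - log2 delta) / log2 c).
    move=> _ [N' nearN' <-].
    have dN' := hdelta N' nearN'; have [gN' _] := nearN'.
    exact: (@MADV0_ge R n c N' (xpoly eps M) delta).
  split; first by apply: lb_le_inf lb; exists (MADV0 c M); exact: (imageP _ nearM).
  rewrite -xN; apply: le_trans (MADV0_le c1 nearN.1).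
  exact: (ge_inf (ex_intro _ _ lb) (imageP _ nearN)).
(* Both bounds differ from [xpoly eps M] by a constant divided by [log2 c]. *)
split=> //; apply: (squeeze_cvgr
  (f := fun c => (xpoly eps M)%:R - (n%:R - log2 delta) / log2 c)
  (h := fun c => (xpoly eps M)%:R + n%:R / log2 c)).
- by near=> c; apply/andP/bounds; near: c; exact: nbhs_pinfty_gt.
- by rewrite -[X in _ --> X]subr0; exact: cvgB (cvg_cst _) (cvg_div_log2 _).
- by rewrite -[X in _ --> X]addr0; exact: cvgD (cvg_cst _) (cvg_div_log2 _).
Unshelve. all: by end_near. Qed.
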